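(* Let $\mathbf b=\{b_n\}_{n\ge1}$ be a nonnegative real sequence with $\mathbf b\in NBVS$. Then the series $\sum_{n=1}^\infty b_n\sin nx$ converges uniformly on $\mathbb R$ if and only if $\lim_{n\to\infty}nb_n=0$. Moreover, if the series converges at every $x\in\mathbb R$, then its sum function $f(x)=\sum_{n=1}^\infty b_n\sin nx$ is continuous on $\mathbb R$ if and only if $\lim_{n\to\infty}nb_n=0$.
   Context: For $\theta_0\in[0,\pi/2)$ let $M(\theta_0)=\{z\in\mathbb C: |\arg z|\le\theta_0\}$ (with $0\in M(\theta_0)$). Write $\Delta c_n=c_n-c_{n+1}$. A complex sequence $\mathbf C=\{c_n\}$ belongs to $NBVS$ if there is $\theta_0\in[0,\pi/2)$ with $c_n\in M(\theta_0)$ for all $n\ge1$ and a constant $K(\mathbf C)>0$ (depending only on $\mathbf C$) such that $\sum_{n=m}^{2m}|\Delta c_n|\le K(\mathbf C)\big(|c_m|+|c_{2m}|\big)$ for all $m=1,2,\dots$. (For nonnegative real sequences the angular condition is automatic.) *)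

(* Defs.v *)
From Stdlib Require Import Reals.
From Coquelicot Require Import Coquelicot.
Open Scope R_scope.

(* Sector M(theta0) = { z : |arg z| <= theta0 } together with 0.
   For theta0 in [0, pi/2) this is exactly { z : Re z >= |z| cos theta0 }
   (writing z = |z| e^{i phi}, Re z = |z| cos phi and cos is decreasing on [0,pi]). *)
Definition in_sector (theta0 : R) (z : C) : Prop :=
  Cmod z * cos theta0 <= Re z.

(* NBVS for complex sequences indexed by n >= 1 (index 0 is ignored). *)
Definition NBVS (c : nat -> C) : Prop :=
  (exists theta0 : R, 0 <= theta0 < PI / 2 /\
     forall n : nat, (1 <= n)%nat -> in_sector theta0 (c n)) /\
  (exists K : R, 0 < K /\
     forall m : nat, (1 <= m)%nat ->
       sum_n_m (fun n => Cmod (c n - c (S n))%C) m (2 * m)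
         <= K * (Cmod (c m) + Cmod (c (2 * m)%nat))).

Definition sin_partial (b : nat -> R) (N : nat) (x : R) : R :=
  sum_n_m (fun n => b n * sin (INR n * x)) 1 N.

Definition sin_series_unif_conv (b : nat -> R) : Prop :=
  exists f : R -> R, forall eps : R, 0 < eps ->
    exists N0 : nat, forall N : nat, (N0 <= N)%nat ->
      forall x : R, Rabs (sin_partial b N x - f x) < eps.

(* Main.v *)
Require Import Defs.
From Stdlib Require Import Reals Lra Lia Arith.
From Coquelicot Require Import Coquelicot.
Open Scope R_scope.

(** The condition [n b_n -> 0] follows as soon as the block sums
    [b_m + ... + b_{2m}] tend to 0, since NBVS gives
    [b_n <= (K + 1) (b_j + b_{2j})] for [n/2 <= j <= n].  Uniform convergence
    makes the blocks small by evaluation at [x = 1/(2m)].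

    For a continuous sum [f], put [G x = sum b_n sin (n x) / n^2].  By Riemann's
    summation theorem the second symmetric derivative of [G] is [- f], and
    [f 0 = 0], so a maximum principle gives [2 G t - G (2 t) = o(t^2)] at 0.
    Integrating, [sum b_n (1 - cos (n x))^2 / n^3 = o(x^3)]; the terms are
    nonnegative, and those with [m <= n <= 2m] at [x = 1/m] bound the block.

    Conversely, NBVS and [n b_n <= eps] for [n >= N] bound the tails of the total
    variation of [b] by [3 K eps / p] (sum over dyadic blocks), and summation by
    parts bounds the tails of the series uniformly in [x]. *)

(** * Finite sums of reals *)

Lemma sum_last (a : nat -> R) (n m : nat) :
  (n <= S m)%nat -> sum_n_m a n (S m) = sum_n_m a n m + a (S m) :> R.
Proof. exact (sum_n_Sm a n m). Qed.

Lemma sum_Chasles (a : nat -> R) (n m k : nat) :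
  (n <= S m)%nat -> (m <= k)%nat ->
  sum_n_m a n k = sum_n_m a n m + sum_n_m a (S m) k :> R.
Proof. exact (sum_n_m_Chasles a n m k). Qed.

Lemma sum_empty (a : nat -> R) (n m : nat) : (m < n)%nat -> sum_n_m a n m = 0 :> R.
Proof. exact (sum_n_m_zero a n m). Qed.

Lemma sum_single (a : nat -> R) (n : nat) : sum_n_m a n n = a n :> R.
Proof. exact (sum_n_n a n). Qed.

Lemma sum_le_loc (a b : nat -> R) (n m : nat) :
  (forall k, (n <= k <= m)%nat -> a k <= b k) -> sum_n_m a n m <= sum_n_m b n m.
Proof.
induction m as [|m IH]; intros H.
- destruct n as [|n].
  + rewrite !sum_single; apply H; lia.
  + rewrite !sum_empty by lia; lra.
- destruct (le_lt_dec n (S m)) as [hn|hn].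
  + rewrite !sum_last by lia.
    apply Rplus_le_compat; [apply IH; intros; apply H; lia | apply H; lia].
  + rewrite !sum_empty by lia; lra.
Qed.

Lemma sum_eq_loc (a b : nat -> R) (n m : nat) :
  (forall k, (n <= k <= m)%nat -> a k = b k) -> sum_n_m a n m = sum_n_m b n m :> R.
Proof. exact (sum_n_m_ext_loc a b n m). Qed.

Lemma sum_nonneg (a : nat -> R) (n m : nat) :
  (forall k, (n <= k <= m)%nat -> 0 <= a k) -> 0 <= sum_n_m a n m.
Proof.
intros H; apply Rle_trans with (sum_n_m (fun _ => 0) n m).
- rewrite sum_n_m_const; lra.
- now apply sum_le_loc.
Qed.

Lemma sum_sub_le (a : nat -> R) (n p q m : nat) :
  (n <= p)%nat -> (p <= S q)%nat -> (q <= m)%nat ->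
  (forall k, (n <= k <= m)%nat -> 0 <= a k) -> sum_n_m a p q <= sum_n_m a n m.
Proof.
intros h1 h2 h3 H.
assert (E : sum_n_m a n q <= sum_n_m a n m).
{ rewrite (sum_Chasles a n q m) by lia.
  assert (0 <= sum_n_m a (S q) m) by (apply sum_nonneg; intros; apply H; lia); lra. }
destruct p as [|p].
- replace n with 0%nat in * by lia; exact E.
- rewrite (sum_Chasles a n p q) in E by lia.
  assert (0 <= sum_n_m a n p) by (apply sum_nonneg; intros; apply H; lia); lra.
Qed.

Lemma sum_add (a b : nat -> R) (n m : nat) :
  sum_n_m (fun k => a k + b k) n m = sum_n_m a n m + sum_n_m b n m :> R.
Proof. exact (sum_n_m_plus a b n m). Qed.

Lemma sum_scal (c : R) (a : nat -> R) (n m : nat) :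
  sum_n_m (fun k => c * a k) n m = c * sum_n_m a n m :> R.
Proof. exact (sum_n_m_mult_l c a n m). Qed.

Lemma Rabs_sum_le (a : nat -> R) (n m : nat) :
  Rabs (sum_n_m a n m) <= sum_n_m (fun k => Rabs (a k)) n m.
Proof. exact (norm_sum_n_m a n m). Qed.

Lemma sum_telescope (u : nat -> R) (n m : nat) :
  (n <= S m)%nat -> sum_n_m (fun k => u k - u (S k)) n m = u n - u (S m) :> R.
Proof.
induction m as [|m IH]; intros h.
- destruct n as [|[|n]]; try lia.
  + now rewrite sum_single.
  + rewrite sum_empty by lia; simpl; ring.
- destruct (Nat.eq_dec n (S (S m))) as [->|hn].
  + rewrite sum_empty by lia; simpl; ring.
  + rewrite sum_last, IH by lia; ring.
Qed.

(** Abel's identity by induction on [q]. The boundary weight is taken at [S q], which keeps the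
    formula valid for the empty range [p = S q], where the induction starts. *)
Lemma summation_by_parts (u w : nat -> R) (p q : nat) :
  (1 <= p)%nat -> (p <= S q)%nat ->
  sum_n_m (fun k => w k * u k) p q =
  sum_n_m (fun k => sum_n_m u p k * (w k - w (S k))) p q
  + w (S q) * sum_n_m u p q :> R.
Proof.
intros hp; induction q as [|q IH]; intros h.
- rewrite !sum_empty by lia; simpl; ring.
- destruct (Nat.eq_dec p (S (S q))) as [->|hn].
  + rewrite !sum_empty by lia; simpl; ring.
  + rewrite (sum_last (fun k => w k * u k)), IH, (sum_last (fun k => _ * _)) by lia.
    rewrite (sum_last u) by lia; ring.
Qed.

(** * Continuity and derivatives of finite sums of functions *)

Lemma ex_derive_continuity_pt (f : R -> R) (x : R) : ex_derive f x -> continuity_pt f x.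
Proof.
intros H; apply continuity_pt_filterlim.
exact (ex_derive_continuous (V := R_NormedModule) f x H).
Qed.

Lemma continuity_pt_sum (g : nat -> R -> R) (n m : nat) (x : R) :
  (forall k, continuity_pt (g k) x) -> continuity_pt (fun y => sum_n_m (fun k => g k y) n m) x.
Proof.
intros H; induction m as [|m IH].
- destruct n as [|n].
  + apply continuity_pt_ext with (2 := H 0%nat); intros y; now rewrite sum_single.
  + apply continuity_pt_ext with (fun _ => 0).
    * intros y; rewrite sum_empty by lia; reflexivity.
    * apply continuity_pt_const; now intros ? ?.
- destruct (le_lt_dec n (S m)) as [hn|hn].
  + apply continuity_pt_ext with (fun y => sum_n_m (fun k => g k y) n m + g (S m) y).
    * intros y; rewrite sum_last by lia; reflexivity.
    * apply continuity_pt_plus; [exact IH | apply H].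
  + apply continuity_pt_ext with (fun _ => 0).
    * intros y; rewrite sum_empty by lia; reflexivity.
    * apply continuity_pt_const; now intros ? ?.
Qed.

Lemma is_derive_sum (g dg : nat -> R -> R) (n m : nat) (x : R) :
  (forall k, (n <= k <= m)%nat -> is_derive (g k) x (dg k x)) ->
  is_derive (fun y => sum_n_m (fun k => g k y) n m) x (sum_n_m (fun k => dg k x) n m).
Proof.
induction m as [|m IH]; intros H.
- destruct n as [|n].
  + rewrite sum_single; apply is_derive_ext with (g 0%nat).
    * intros y; now rewrite sum_single.
    * apply H; lia.
  + rewrite sum_empty by lia; apply is_derive_ext with (fun _ => 0).
    * intros y; rewrite sum_empty by lia; reflexivity.
    * auto_derive; trivial.
- destruct (le_lt_dec n (S m)) as [hn|hn].
  + rewrite sum_last by lia.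
    apply is_derive_ext with (fun y => sum_n_m (fun k => g k y) n m + g (S m) y).
    * intros y; rewrite sum_last by lia; reflexivity.
    * apply (is_derive_plus (V := R_NormedModule)); [apply IH; intros; apply H; lia | apply H; lia].
  + rewrite sum_empty by lia; apply is_derive_ext with (fun _ => 0).
    * intros y; rewrite sum_empty by lia; reflexivity.
    * auto_derive; trivial.
Qed.

(** * Sine inequalities and sums of [sin (k x)] *)

Lemma Rabs_sin_le (x : R) : Rabs (sin x) <= Rabs x.
Proof.
assert (H : forall y, 0 <= y -> Rabs (sin y) <= y).
{ intros y [hy|<-]; [|rewrite sin_0, Rabs_R0; lra].
  pose proof (SIN_bound y).
  destruct (Rle_lt_dec y 1) as [h1|h1].
  - rewrite Rabs_pos_eq; [left; now apply sin_lt_x|].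
    left; apply sin_pos_tech; lra.
  - apply Rle_trans with 1; [apply Rabs_le; lra | lra]. }
destruct (Rle_lt_dec 0 x) as [h|h].
- rewrite (Rabs_pos_eq x) by lra; now apply H.
- rewrite (Rabs_left x), <- Rabs_Ropp, <- sin_neg by lra; apply H; lra.
Qed.

(** Induction by the addition formula, the cosines being at most 1 in absolute value. Keeping
    [|sin x|] rather than [|x|] on the right matches the quantity in [sum_sin_bound]. *)
Lemma Rabs_sin_mult_le (k : nat) (x : R) : Rabs (sin (INR k * x)) <= INR k * Rabs (sin x).
Proof.
induction k as [|k IH].
- simpl INR; rewrite !Rmult_0_l, sin_0, Rabs_R0; lra.
- rewrite S_INR.
  replace ((INR k + 1) * x) with (INR k * x + x) by ring.
  rewrite sin_plus.
  apply Rle_trans with (1 := Rabs_triang _ _).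
  rewrite !Rabs_mult.
  assert (Rabs (cos x) <= 1) by (apply Rabs_le; pose proof (COS_bound x); lra).
  assert (Rabs (cos (INR k * x)) <= 1)
    by (apply Rabs_le; pose proof (COS_bound (INR k * x)); lra).
  pose proof (Rabs_pos (sin (INR k * x))); pose proof (Rabs_pos (sin x)).
  nra.
Qed.

(** Each term is a difference of cosines at consecutive half-integers, and these telescope. *)
Lemma sum_sin_kernel (x : R) (p q : nat) :
  (1 <= p)%nat -> (p <= S q)%nat ->
  2 * sin (x / 2) * sum_n_m (fun k => sin (INR k * x)) p q =
  cos ((INR p - 1 / 2) * x) - cos ((INR q + 1 / 2) * x).
Proof.
intros hp h.
rewrite <- sum_scal.
transitivity (sum_n_m (fun k => cos ((INR k - 1 / 2) * x) - cos ((INR (S k) - 1 / 2) * x)) p q).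
- apply sum_eq_loc; intros k _.
  rewrite S_INR.
  replace ((INR k - 1 / 2) * x) with (INR k * x - x / 2) by field.
  replace ((INR k + 1 - 1 / 2) * x) with (INR k * x + x / 2) by field.
  rewrite cos_minus, cos_plus; ring.
- rewrite (sum_telescope (fun k => cos ((INR k - 1 / 2) * x))) by lia.
  rewrite S_INR; do 2 f_equal; field.
Qed.

(** Left as a product, so that points with [sin (x / 2) = 0] need no separate treatment. *)
Lemma sum_sin_bound (x : R) (p q : nat) :
  (1 <= p)%nat -> (p <= S q)%nat ->
  Rabs (sin (x / 2)) * Rabs (sum_n_m (fun k => sin (INR k * x)) p q) <= 1.
Proof.
intros hp h.
rewrite <- Rabs_mult.
pose proof (sum_sin_kernel x p q hp h) as E.
pose proof (COS_bound ((INR p - 1 / 2) * x)); pose proof (COS_bound ((INR q + 1 / 2) * x)).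
apply Rabs_le; lra.
Qed.

(** * Riemann's kernel and its variation *)

(** A second symmetric difference of step [2 h] turns [sin (n x) / n^2] into
    [- (2 h)^2 * sinc_sq (n h) * sin (n x)]. The value at 0 is 0 here, not the limit 1, so the
    lemmas take [t > 0]. *)
Definition sinc_sq (t : R) : R := (sin t / t)².

(** The derivative [u * sin u] lies between 0 and [t^2] for [0 <= u <= t <= 1]; the mean value
    theorem multiplies this by [t]. *)
Lemma sin_minus_tcos_bound (t : R) : 0 < t <= 1 -> 0 <= sin t - t * cos t <= t ^ 3.
Proof.
intros ht.
destruct (MVT_gen (fun u => sin u - u * cos u) 0 t (fun u => u * sin u)) as [c [hc E]].
- intros u _; auto_derive; [trivial | ring].
- intros u _; apply ex_derive_continuity_pt.
  auto_derive; trivial.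
- rewrite Rmin_left, Rmax_right in hc by lra.
  rewrite sin_0 in E.
  assert (0 <= sin c <= c).
  { split.
    - apply sin_ge_0; [lra|]. pose proof PI2_1; lra.
    - pose proof (Rabs_sin_le c) as h; rewrite (Rabs_pos_eq c) in h by lra.
      apply Rle_trans with (2 := h), RRle_abs. }
  assert (c * sin c <= t * t) by nra.
  assert (0 <= c * sin c) by nra.
  replace (t ^ 3) with (t * t * t) by ring.
  nra.
Qed.

Lemma sinc_sq_bound (t : R) : 0 < t -> 0 <= sinc_sq t <= 1.
Proof.
intros ht; split; [apply Rle_0_sqr|].
unfold sinc_sq, Rdiv; rewrite Rsqr_mult, Rsqr_inv'.
pose proof (Rabs_sin_le t) as h.
apply Rsqr_le_abs_1 in h.
assert (0 < t²) by (apply Rlt_0_sqr; lra).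
apply (Rmult_le_reg_r (t²)); [lra|].
rewrite Rmult_assoc, Rinv_l; lra.
Qed.

(** For [t <= 1], [sin_minus_tcos_bound] gives [cos t <= sin t / t], so the left side is at most
    [(sin t)^2]; for [t > 1] the right side exceeds 1. *)
Lemma sinc_sq_near_1 (t : R) : 0 < t -> 1 - sinc_sq t <= t ^ 2.
Proof.
intros ht.
destruct (Rle_lt_dec t 1) as [h1|h1].
- pose proof (sin_minus_tcos_bound t (conj ht h1)) as hs.
  assert (hc : 0 <= cos t) by (apply cos_ge_0; pose proof PI2_1; lra).
  assert (hd : cos t <= sin t / t)
    by (apply Rle_div_r; [lra|]; lra).
  assert ((cos t)² <= sinc_sq t) by (apply Rsqr_incr_1; lra).
  pose proof (sin2_cos2 t) as E.
  pose proof (Rabs_sin_le t) as h; apply Rsqr_le_abs_1 in h.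
  unfold Rsqr in *; nra.
- pose proof (sinc_sq_bound t ht); nra.
Qed.

Lemma is_derive_sinc_sq (t : R) :
  0 < t -> is_derive sinc_sq t (- (2 * sin t * (sin t - t * cos t) / t ^ 3)).
Proof.
intros ht; unfold sinc_sq, Rsqr; auto_derive; [lra | field; lra].
Qed.

(** The quotient is at most 2 for [t <= 1] and at most [4 / t^2] for [t > 1], while [1 + t^2] is at
    most 2 and [2 t^2] respectively. *)
Lemma sinc_sq_derive_bound (t : R) :
  0 < t -> Rabs (2 * sin t * (sin t - t * cos t) / t ^ 3) <= 8 / (1 + t²).
Proof.
intros ht.
assert (h3 : 0 < t ^ 3) by (apply pow_lt; lra).
assert (h2 : 0 < t²) by (apply Rlt_0_sqr; lra).
rewrite Rabs_div, (Rabs_pos_eq (t ^ 3)), !Rabs_mult, (Rabs_pos_eq 2) by lra.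
apply Rle_div_l; [lra|].
pose proof (Rabs_pos (sin t)).
pose proof (Rabs_pos (sin t - t * cos t)).
replace (8 / (1 + t²) * t ^ 3) with (8 * t ^ 3 / (1 + t²)) by (field; lra).
apply (Rle_div_r _ _ (1 + t²)); [lra|].
unfold Rsqr in *.
destruct (Rle_lt_dec t 1) as [h1|h1].
- pose proof (sin_minus_tcos_bound t (conj ht h1)) as hs.
  rewrite (Rabs_pos_eq (sin t - _)) by lra.
  pose proof (Rabs_sin_le t) as h; rewrite (Rabs_pos_eq t) in h by lra.
  assert (2 * Rabs (sin t) * (sin t - t * cos t) <= 2 * 1 * t ^ 3)
    by (apply Rmult_le_compat; nra).
  assert (0 <= 2 * Rabs (sin t) * (sin t - t * cos t)) by (apply Rmult_le_pos; lra).
  apply Rle_trans with (2 * 1 * t ^ 3 * (1 + t * t)).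
  + apply Rmult_le_compat_r; [nra | lra].
  + assert (t * t <= 1) by nra; nra.
- pose proof (SIN_bound t); pose proof (COS_bound t).
  assert (Rabs (sin t) <= 1) by (apply Rabs_le; lra).
  assert (Rabs (sin t - t * cos t) <= 2 * t) by (apply Rabs_le; nra).
  assert (2 * Rabs (sin t) * Rabs (sin t - t * cos t) <= 2 * 1 * (2 * t))
    by (apply Rmult_le_compat; nra).
  apply Rle_trans with (2 * 1 * (2 * t) * (1 + t * t)).
  + apply Rmult_le_compat_r; [nra | lra].
  + replace (t ^ 3) with (t * (t * t)) by ring; assert (1 <= t * t) by nra; nra.
Qed.

(* The bound on the derivative makes [8 * atan] a majorant of the variation of [sinc_sq]. *)
Lemma sinc_sq_increment (s t : R) :
  0 < s <= t -> Rabs (sinc_sq s - sinc_sq t) <= 8 * (atan t - atan s).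
Proof.
intros h.
(* One mean value argument serves both signs: [8 * atan u - sg * sinc_sq u] is nondecreasing for
   [sg] equal to 1 or -1. *)
assert (D : forall sg, sg = 1 \/ sg = -1 ->
  0 <= 8 * (atan t - atan s) + sg * (sinc_sq s - sinc_sq t)).
{ intros sg hsg.
  destruct (MVT_gen (fun u => 8 * atan u - sg * sinc_sq u) s t
    (fun u => 8 / (1 + u²) + sg * (2 * sin u * (sin u - u * cos u) / u ^ 3)))
    as [c [hc E]].
  - intros u hu; rewrite Rmin_left, Rmax_right in hu by lra.
    replace (8 / (1 + u²) + sg * (2 * sin u * (sin u - u * cos u) / u ^ 3)) with
      (minus (8 * / (1 + u²)) (sg * - (2 * sin u * (sin u - u * cos u) / u ^ 3)))
      by (unfold minus, plus, opp; simpl; unfold Rdiv; ring).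
    apply (is_derive_minus (V := R_NormedModule)); apply is_derive_scal.
    + apply is_derive_Reals; replace (/ (1 + u²)) with (/ (1 + u ^ 2)) by (unfold Rsqr; f_equal; ring);
      apply derivable_pt_lim_atan.
    + apply is_derive_sinc_sq; lra.
  - intros u hu; rewrite Rmin_left, Rmax_right in hu by lra.
    apply continuity_pt_minus; apply continuity_pt_mult;
      try (apply continuity_pt_const; now intros ? ?).
    + apply derivable_continuous_pt, derivable_pt_atan.
    + apply ex_derive_continuity_pt.
      eexists; apply is_derive_sinc_sq; lra.
  - rewrite Rmin_left, Rmax_right in hc by lra.
    pose proof (sinc_sq_derive_bound c ltac:(lra)) as hb.
    apply Rabs_le_between in hb.
    assert (0 <= (8 / (1 + c²) + sg * (2 * sin c * (sin c - c * cos c) / c ^ 3)) * (t - s)).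
    { apply Rmult_le_pos; [|lra]. destruct hsg as [->| ->]; lra. }
    lra. }
pose proof (D 1 (or_introl eq_refl)); pose proof (D (-1) (or_intror eq_refl)).
apply Rabs_le; lra.
Qed.

(** The arctangent bounds telescope to at most [8 * (PI / 2)], and [PI <= 4]. That the bound is free
    of [h] is what [riemann_summation] rests on. *)
Lemma sinc_sq_variation (h : R) (p q : nat) :
  0 < h -> (1 <= p)%nat -> (p <= S q)%nat ->
  sum_n_m (fun k => Rabs (sinc_sq (INR k * h) - sinc_sq (INR (S k) * h))) p q <= 16.
Proof.
intros hh hp hq.
apply Rle_trans with
  (sum_n_m (fun k => (-8) * atan (INR k * h) - (-8) * atan (INR (S k) * h)) p q).
- apply sum_le_loc; intros k hk.
  assert (0 < INR k) by (apply lt_0_INR; lia).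
  pose proof (sinc_sq_increment (INR k * h) (INR (S k) * h)) as Hf.
  rewrite S_INR in *.
  enough (Rabs (sinc_sq (INR k * h) - sinc_sq ((INR k + 1) * h)) <=
    8 * (atan ((INR k + 1) * h) - atan (INR k * h))) by lra.
  apply Hf; nra.
- rewrite (sum_telescope (fun k => (-8) * atan (INR k * h))) by lia.
  assert (0 < INR p) by (apply lt_0_INR; lia).
  assert (atan 0 < atan (INR p * h)) by (apply atan_increasing; nra).
  rewrite atan_0 in *.
  pose proof (atan_bound (INR (S q) * h)).
  pose proof PI_4.
  lra.
Qed.

(** * Riemann's summation method *)

(** Abel summation moves the differences onto the weights [w k = sinc_sq (k h)]. Where the partial
    sums are not yet close to [s], the weights are within [O(h)] of 1; beyond, their total variation
    is at most 16. *)
Lemma riemann_summation (a : nat -> R) (s : R) :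
  is_lim_seq (fun N => sum_n_m a 1 N) s ->
  forall eps, 0 < eps -> exists delta, 0 < delta /\
  forall h, 0 < h < delta -> exists M0, forall M, (M0 <= M)%nat ->
  Rabs (sum_n_m (fun n => sinc_sq (INR n * h) * a n) 1 M - s) <= eps.
Proof.
intros Hs eps he.
set (S_ := fun N => sum_n_m a 1 N) in *.
assert (HB : exists B, 0 < B /\ forall n, Rabs (S_ n - s) <= B).
{ destruct (filterlim_bounded (fun n => S_ n - s)) as [B HB].
  - exists (s - s). apply (is_lim_seq_minus' S_ (fun _ => s) s s Hs (is_lim_seq_const s)).
  - exists (Rabs B + 1); split; [pose proof (Rabs_pos B); lra|].
    intros n; apply Rle_trans with (1 := HB n).
    pose proof (RRle_abs B); lra. }
destruct HB as [B [hB HB]].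
apply is_lim_seq_spec in Hs.
(* The tail costs [16 * eps / 36] and the boundary term [eps / 36]; with [eps / 4] for the terms
   linear in [h], the total stays below [eps]. *)
assert (he1 : 0 < eps / 36) by lra.
destruct (Hs (mkposreal _ he1)) as [N0 HN0]; simpl in HN0.
set (A := INR (S N0)).
assert (hA : 1 <= A) by (unfold A; rewrite S_INR; pose proof (pos_INR N0); lra).
(* [Q] is the coefficient of [h] in the bounds [E1] and [E3] together. *)
set (Q := Rabs s + 2 * B * A ^ 3).
assert (hQ : 0 < Q).
{ unfold Q; pose proof (Rabs_pos s). assert (0 < A ^ 3) by (apply pow_lt; lra). nra. }
exists (Rmin 1 (eps / 4 / Q)); split.
{ apply Rmin_glb_lt; [lra|]. apply Rdiv_lt_0_compat; lra. }
intros h [hh0 hh].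
assert (hh1 : h < 1) by (apply Rlt_le_trans with (1 := hh), Rmin_l).
assert (hh2 : h * Q < eps / 4).
{ apply Rlt_div_r; [exact hQ|]. apply Rlt_le_trans with (1 := hh), Rmin_r. }
exists (S N0); intros M hM.
rewrite summation_by_parts by lia.
fold (S_ M).
set (w := fun k => sinc_sq (INR k * h)).
assert (hw : forall k, (1 <= k)%nat -> 0 <= w k <= 1 /\ 1 - w k <= (INR k * h) ^ 2).
{ intros k hk. assert (0 < INR k * h) by (apply Rmult_lt_0_compat; [apply lt_0_INR; lia | lra]).
  split; [now apply sinc_sq_bound | now apply sinc_sq_near_1]. }
(* Recentre the partial sums at [s]; the constant part telescopes. *)
replace (sum_n_m (fun k => sum_n_m a 1 k * (sinc_sq (INR k * h) - sinc_sq (INR (S k) * h))) 1 M)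
  with (s * (w 1%nat - w (S M)) + sum_n_m (fun k => (S_ k - s) * (w k - w (S k))) 1 M).
2:{ rewrite <- (sum_telescope w 1 M), <- sum_scal, <- sum_add by lia.
    apply sum_eq_loc; intros k _; unfold S_, w; ring. }
fold (w (S M)).
replace (s * (w 1%nat - w (S M)) + sum_n_m (fun k => (S_ k - s) * (w k - w (S k))) 1 M +
  w (S M) * S_ M - s) with
  (- (s * (1 - w 1%nat)) + (S_ M - s) * w (S M) + sum_n_m (fun k => (S_ k - s) * (w k - w (S k))) 1 M)
  by ring.
rewrite (sum_Chasles _ 1 N0 M) by lia.
assert (E1 : Rabs (s * (1 - w 1%nat)) <= Rabs s * h).
{ destruct (hw 1%nat ltac:(lia)) as [h1 h2]; simpl INR in h2.
  rewrite Rabs_mult, (Rabs_pos_eq (1 - _)) by lra.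
  apply Rmult_le_compat_l; [apply Rabs_pos|]. nra. }
assert (E2 : Rabs ((S_ M - s) * w (S M)) <= eps / 36).
{ destruct (hw (S M) ltac:(lia)) as [h1 _].
  pose proof (HN0 M ltac:(lia)). pose proof (Rabs_pos (S_ M - s)).
  rewrite Rabs_mult, (Rabs_pos_eq (w _)) by lra. nra. }
assert (E3 : Rabs (sum_n_m (fun k => (S_ k - s) * (w k - w (S k))) 1 N0) <= 2 * B * A ^ 3 * h).
{ apply Rle_trans with (1 := Rabs_sum_le _ _ _).
  apply Rle_trans with (sum_n_m (fun _ => B * (2 * A ^ 2 * h)) 1 N0).
  - apply sum_le_loc; intros k hk.
    rewrite Rabs_mult.
    apply Rmult_le_compat; try apply Rabs_pos; [apply HB|].
    destruct (hw k ltac:(lia)) as [h1 h2]; destruct (hw (S k) ltac:(lia)) as [h3 h4].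
    assert (Hk : forall j, (j <= S N0)%nat -> (INR j * h) ^ 2 <= A ^ 2 * h).
    { intros j hj. assert (0 <= INR j <= A) by (split; [apply pos_INR | apply le_INR, hj]).
      rewrite Rpow_mult_distr. apply Rmult_le_compat; try apply pow2_ge_0.
      - apply pow_incr; lra.
      - nra. }
    pose proof (Hk k ltac:(lia)); pose proof (Hk (S k) ltac:(lia)).
    apply Rabs_le; lra.
  - rewrite sum_n_m_const.
    replace (2 * B * A ^ 3 * h) with (A * (B * (2 * A ^ 2 * h))) by ring.
    apply Rmult_le_compat_r.
    + assert (0 < A ^ 2) by (apply pow_lt; lra).
      apply Rmult_le_pos; nra.
    + apply le_INR; lia. }
assert (E4 : Rabs (sum_n_m (fun k => (S_ k - s) * (w k - w (S k))) (S N0) M) <= eps / 36 * 16).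
{ apply Rle_trans with (1 := Rabs_sum_le _ _ _).
  apply Rle_trans with (eps / 36 * sum_n_m (fun k => Rabs (w k - w (S k))) (S N0) M).
  - rewrite <- sum_scal; apply sum_le_loc; intros k hk.
    rewrite Rabs_mult; apply Rmult_le_compat_r; [apply Rabs_pos|].
    left; apply HN0; lia.
  - apply Rmult_le_compat_l; [lra|]. apply sinc_sq_variation; lia || lra. }
unfold Q in hh2.
apply Rabs_le_between in E1; apply Rabs_le_between in E2;
apply Rabs_le_between in E3; apply Rabs_le_between in E4.
apply Rabs_le; lra.
Qed.

(** * Uniform limits and second symmetric differences *)

(** Shaped so that [exists f, unif_lim (sin_partial b) f] is convertible with
    [sin_series_unif_conv b]. *)
Definition unif_lim (S : nat -> R -> R) (f : R -> R) : Prop :=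
  forall eps : R, 0 < eps ->
    exists N0 : nat, forall N : nat, (N0 <= N)%nat ->
      forall x : R, Rabs (S N x - f x) < eps.

(** The limit is the pointwise one, given by completeness; the uniform estimate comes from letting
    [M] grow in the Cauchy bound. *)
Lemma unif_cauchy_lim (S : nat -> R -> R) :
  (forall eps, 0 < eps -> exists N0, forall N M, (N0 <= N)%nat -> (N <= M)%nat ->
     forall x, Rabs (S M x - S N x) <= eps) ->
  exists f, unif_lim S f.
Proof.
intros HC.
assert (HL : forall x, is_lim_seq (fun n => S n x) (real (Lim_seq (fun n => S n x)))).
{ intros x; apply Lim_seq_correct'; apply ex_lim_seq_cauchy_corr; intros eps.
  destruct (HC (eps / 2)) as [N0 HN]; [apply is_pos_div_2|].
  assert (0 < eps) by apply cond_pos.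
  exists N0; intros n m hn hm.
  destruct (le_lt_dec n m) as [h|h].
  - rewrite Rabs_minus_sym; apply Rle_lt_trans with (1 := HN n m hn h x); lra.
  - apply Rle_lt_trans with (1 := HN m n hm (Nat.lt_le_incl _ _ h) x); lra. }
exists (fun x => real (Lim_seq (fun n => S n x))); intros eps he.
destruct (HC (eps / 2)) as [N0 HN]; [lra|].
exists N0; intros N hN x.
apply Rle_lt_trans with (eps / 2); [|lra].
specialize (HL x); apply is_lim_seq_spec in HL.
apply Rle_plus_epsilon; intros d hd.
destruct (HL (mkposreal d hd)) as [M0 HM]; simpl in HM.
specialize (HM (Nat.max M0 N) (Nat.le_max_l _ _)).
specialize (HN N (Nat.max M0 N) hN (Nat.le_max_r _ _) x).
apply Rabs_lt_between in HM; apply Rabs_le_between in HN.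
apply Rabs_le; lra.
Qed.

Lemma unif_lim_continuity (S : nat -> R -> R) (f : R -> R) :
  unif_lim S f -> (forall N x, continuity_pt (S N) x) -> forall x, continuity_pt f x.
Proof.
intros HU HS x eps he.
destruct (HU (eps / 3)) as [N0 HN]; [lra|].
destruct (HS N0 x (eps / 3)) as [d [hd Hd]]; [lra|].
exists d; split; [exact hd|]; intros y hy.
specialize (Hd y hy); simpl in Hd |- *; unfold R_dist in *.
pose proof (HN N0 (le_n _) x) as h1; pose proof (HN N0 (le_n _) y) as h2.
apply Rabs_lt_between in h1; apply Rabs_lt_between in h2; apply Rabs_lt_between in Hd.
apply Rabs_lt_between; lra.
Qed.

(* Subtracting the chord and a slightly too convex parabola would leave a function
   with an interior minimum, where its second differences cannot be negative. *)
Lemma second_difference_le (G : R -> R) (a r eps : R) :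
  0 < r ->
  (forall x, a - r <= x <= a + r -> continuity_pt G x) ->
  (forall x, a - r < x < a + r -> forall eta, 0 < eta -> exists delta, 0 < delta /\
     forall h, 0 < h < delta -> G (x + h) + G (x - h) - 2 * G x <= (eps + eta) * h ^ 2) ->
  G (a + r) + G (a - r) - 2 * G a <= eps * r ^ 2.
Proof.
intros hr HG HD.
apply Rnot_lt_le; intros hgap.
set (gap := G (a + r) + G (a - r) - 2 * G a - eps * r ^ 2).
assert (hg : 0 < gap) by (unfold gap; lra).
assert (hr2 : 0 < r ^ 2) by (apply pow_lt; lra).
(* With this [e] the function [phi] is larger by [gap / 4] at both endpoints than at [a], so its
   minimum is interior. *)
set (e := gap / (2 * r ^ 2)).
assert (he : 0 < e) by (apply Rdiv_lt_0_compat; lra).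
assert (Ee : e * r ^ 2 = gap / 2) by (unfold e; field; lra).
set (sl := (G (a + r) - G (a - r)) / (2 * r)).
assert (Es : sl * r = (G (a + r) - G (a - r)) / 2) by (unfold sl; field; lra).
set (phi := fun x => G x - (sl * (x - a) + (eps + e) * (x - a) ^ 2 / 2)).
destruct (continuity_ab_min phi (a - r) (a + r)) as [xi [Hmin hxi]]; [lra| |].
{ intros x hx; apply continuity_pt_minus; [now apply HG|].
  apply ex_derive_continuity_pt; auto_derive; trivial. }
assert (Ep : phi (a + r) = phi a + gap / 4).
{ unfold phi, gap in *.
  replace (sl * (a + r - a)) with (sl * r) by ring.
  replace ((eps + e) * (a + r - a) ^ 2 / 2) with ((eps * r ^ 2 + e * r ^ 2) / 2) by field.
  rewrite Es, Ee; field. }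
assert (Em : phi (a - r) = phi a + gap / 4).
{ unfold phi, gap in *.
  replace (sl * (a - r - a)) with (- (sl * r)) by ring.
  replace ((eps + e) * (a - r - a) ^ 2 / 2) with ((eps * r ^ 2 + e * r ^ 2) / 2) by field.
  rewrite Es, Ee; field. }
pose proof (Hmin a ltac:(lra)) as ha.
assert (hint : a - r < xi < a + r).
{ split.
  - destruct (proj1 hxi) as [h|h]; [exact h|]. rewrite <- h in ha; lra.
  - destruct (proj2 hxi) as [h|h]; [exact h|]. rewrite h in ha; lra. }
destruct (HD xi hint (e / 2)) as [d [hd Hd]]; [lra|].
set (h := Rmin (d / 2) (Rmin (xi - (a - r)) (a + r - xi))).
assert (hh : 0 < h) by (unfold h; repeat apply Rmin_glb_lt; lra).
assert (hh1 : h <= d / 2) by apply Rmin_l.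
assert (hh2 : h <= xi - (a - r)) by (eapply Rle_trans; [apply Rmin_r | apply Rmin_l]).
assert (hh3 : h <= a + r - xi) by (eapply Rle_trans; [apply Rmin_r | apply Rmin_r]).
specialize (Hd h ltac:(lra)).
pose proof (Hmin (xi + h) ltac:(lra)) as h1; pose proof (Hmin (xi - h) ltac:(lra)) as h2.
(* Minimality makes this nonnegative, while the hypothesis at [xi] makes it at most
   [- e * h^2 / 2]. *)
assert (E : phi (xi + h) + phi (xi - h) - 2 * phi xi =
  G (xi + h) + G (xi - h) - 2 * G xi - (eps + e) * h ^ 2) by (unfold phi; field).
assert (0 < e * h ^ 2) by (apply Rmult_lt_0_compat; [lra | apply pow_lt; lra]).
lra.
Qed.

Lemma second_difference_bound (G : R -> R) (a r eps : R) :
  0 < r ->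
  (forall x, a - r <= x <= a + r -> continuity_pt G x) ->
  (forall x, a - r < x < a + r -> forall eta, 0 < eta -> exists delta, 0 < delta /\
     forall h, 0 < h < delta ->
     Rabs (G (x + h) + G (x - h) - 2 * G x) <= (eps + eta) * h ^ 2) ->
  Rabs (G (a + r) + G (a - r) - 2 * G a) <= eps * r ^ 2.
Proof.
intros hr HG HD.
apply Rabs_le; split.
- enough (- G (a + r) + - G (a - r) - 2 * - G a <= eps * r ^ 2) by lra.
  apply (second_difference_le (fun x => - G x) a r eps hr).
  + intros x hx; now apply continuity_pt_opp, HG.
  + intros x hx eta he; destruct (HD x hx eta he) as [d [hd Hd]].
    exists d; split; [exact hd|]; intros h hh.
    specialize (Hd h hh); apply Rabs_le_between in Hd; lra.
- apply (second_difference_le G a r eps hr HG).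
  intros x hx eta he; destruct (HD x hx eta he) as [d [hd Hd]].
  exists d; split; [exact hd|]; intros h hh.
  specialize (Hd h hh); apply Rabs_le_between in Hd; lra.
Qed.

(** * The sine series integrated two and three times *)

(** Up to sign, the partial sum integrated twice term by term: Riemann's function in the limit. *)
Definition int2_partial (b : nat -> R) (N : nat) (x : R) : R :=
  sum_n_m (fun n => b n / INR n ^ 2 * sin (INR n * x)) 1 N.

(* A primitive of [2 * int2_partial b N t - int2_partial b N (2 * t)], chosen because
   its terms are nonnegative. *)
Definition int3_partial (b : nat -> R) (N : nat) (x : R) : R :=
  sum_n_m (fun n => b n / INR n ^ 3 * (1 - cos (INR n * x)) ^ 2) 1 N.

Lemma INR_ge_1 (n : nat) : (1 <= n)%nat -> 1 <= INR n.
Proof. exact (le_INR 1 n). Qed.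

Lemma sum_sub_1 (a : nat -> R) (N M : nat) :
  (N <= M)%nat -> sum_n_m a 1 M - sum_n_m a 1 N = sum_n_m a (S N) M :> R.
Proof. intros h; rewrite (sum_Chasles a 1 N M) by lia; ring. Qed.

(** Comparison with [B / ((k - 1) * k)], which telescopes. *)
Lemma int2_partial_unif_cauchy (b : nat -> R) (B : R) :
  (forall n, (1 <= n)%nat -> Rabs (b n) <= B) ->
  exists G, unif_lim (int2_partial b) G.
Proof.
intros HB; apply unif_cauchy_lim; intros eps he.
assert (hB : 0 <= B) by (apply Rle_trans with (2 := HB 1%nat (le_n _)), Rabs_pos).
destruct (INR_unbounded (B / eps)) as [N0 hN0].
exists (S N0); intros N M hN hM x.
unfold int2_partial; rewrite sum_sub_1 by lia.
apply Rle_trans with (1 := Rabs_sum_le _ _ _).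
apply Rle_trans with (sum_n_m (fun k => B / (INR k - 1) - B / (INR (S k) - 1)) (S N) M).
- apply sum_le_loc; intros k hk.
  assert (h1 : 2 <= INR k) by (apply (le_INR 2); lia).
  rewrite S_INR, Rabs_mult, Rabs_div, (Rabs_pos_eq (INR k ^ 2)); try nra.
  apply Rle_trans with (B / INR k ^ 2 * 1).
  + apply Rmult_le_compat; try apply Rabs_pos.
    * apply Rdiv_le_0_compat; [apply Rabs_pos | nra].
    * apply Rmult_le_compat_r; [left; apply Rinv_0_lt_compat; nra | apply HB; lia].
    * apply Rabs_le; pose proof (SIN_bound (INR k * x)); lra.
  + replace (B / (INR k - 1) - B / (INR k + 1 - 1)) with (B * / ((INR k - 1) * INR k))
      by (field; lra).
    rewrite Rmult_1_r; apply Rmult_le_compat_l; [exact hB|].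
    apply Rinv_le_contravar; nra.
- rewrite (sum_telescope (fun k => B / (INR k - 1))) by lia.
  rewrite !S_INR.
  assert (INR N0 + 1 <= INR N) by (rewrite <- S_INR; apply le_INR; lia).
  assert (INR N <= INR M) by (apply le_INR; lia).
  pose proof (pos_INR N0).
  assert (0 <= B / (INR M + 1 - 1)) by (apply Rdiv_le_0_compat; lra).
  enough (B / (INR N + 1 - 1) <= eps) by lra.
  apply Rle_div_l; [lra|].
  apply (Rlt_div_l _ _ eps) in hN0; [|lra].
  nra.
Qed.

(** From [sin (y + 2 t) + sin (y - 2 t) - 2 sin y = - 4 (sin t)^2 sin y] with [t = n h]; the step
    [2 h] puts the kernel at exactly [n h]. *)
Lemma int2_second_difference (b : nat -> R) (N : nat) (x h : R) :
  0 < h ->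
  int2_partial b N (x + 2 * h) + int2_partial b N (x - 2 * h) - 2 * int2_partial b N x =
  - (2 * h) ^ 2 * sum_n_m (fun n => sinc_sq (INR n * h) * (b n * sin (INR n * x))) 1 N.
Proof.
intros hh; unfold int2_partial.
replace (- (2 * h) ^ 2) with (- (4 * h ^ 2)) by ring.
unfold Rminus at 1; rewrite <- Ropp_mult_distr_l_reverse.
rewrite <- !sum_scal, <- !sum_add.
apply sum_eq_loc; intros k hk.
pose proof (INR_ge_1 k ltac:(lia)).
unfold sinc_sq, Rsqr.
replace (INR k * (x + 2 * h)) with (INR k * x + 2 * (INR k * h)) by ring.
replace (INR k * (x - 2 * h)) with (INR k * x - 2 * (INR k * h)) by ring.
rewrite sin_plus, sin_minus, cos_2a_sin.
field; lra.
Qed.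

(** [riemann_summation] applied to the series at [x], with [N] going to infinity in
    [int2_second_difference] for each fixed step. *)
Lemma int2_schwarz_derivative (b : nat -> R) (f G : R -> R) :
  (forall x, is_lim_seq (fun N => sin_partial b N x) (f x)) ->
  unif_lim (int2_partial b) G ->
  forall x eta, 0 < eta -> exists delta, 0 < delta /\
    forall h, 0 < h < delta ->
    Rabs (G (x + h) + G (x - h) - 2 * G x + f x * h ^ 2) <= eta * h ^ 2.
Proof.
intros Hf HG x eta he.
destruct (riemann_summation _ _ (Hf x) eta he) as [d [hd Hd]].
exists (2 * d); split; [lra|]; intros h hh.
destruct (Hd (h / 2)) as [M0 HM]; [lra|].
apply Rle_plus_epsilon; intros e hep.
(* A second difference has four values counted with multiplicity, so [e / 4] at each costs [e]. *)
destruct (HG (e / 4)) as [N0 HN]; [lra|].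
set (N := Nat.max M0 N0).
specialize (HM N (Nat.le_max_l _ _)).
assert (HN' := HN N (Nat.le_max_r _ _)).
pose proof (int2_second_difference b N x (h / 2) ltac:(lra)) as E.
replace (2 * (h / 2)) with h in E by field.
pose proof (HN' x) as h1; pose proof (HN' (x + h)) as h2; pose proof (HN' (x - h)) as h3.
apply Rabs_lt_between in h1; apply Rabs_lt_between in h2; apply Rabs_lt_between in h3.
apply Rabs_le_between in HM.
match type of E with _ = _ * ?X => set (R_ := X) in * end.
assert (0 <= h ^ 2) by apply pow2_ge_0.
assert (- eta * h ^ 2 <= (R_ - f x) * h ^ 2 <= eta * h ^ 2).
{ split; apply Rmult_le_compat_r; lra. }
apply Rabs_le; lra.
Qed.

Lemma is_derive_int3 (b : nat -> R) (N : nat) (x : R) :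
  is_derive (int3_partial b N) x (2 * int2_partial b N x - int2_partial b N (2 * x)).
Proof.
unfold int2_partial.
replace (2 * _ - _) with (sum_n_m (fun n =>
  b n / INR n ^ 3 * (2 * (1 - cos (INR n * x)) * (INR n * sin (INR n * x)))) 1 N).
- apply (is_derive_sum (fun n y => b n / INR n ^ 3 * (1 - cos (INR n * y)) ^ 2)
    (fun n y => b n / INR n ^ 3 * (2 * (1 - cos (INR n * y)) * (INR n * sin (INR n * y))))).
  intros k hk; auto_derive; [trivial | simpl; ring].
- unfold Rminus at 2.
  replace (- sum_n_m (fun n => b n / INR n ^ 2 * sin (INR n * (2 * x))) 1 N) with
    (-1 * sum_n_m (fun n => b n / INR n ^ 2 * sin (INR n * (2 * x))) 1 N) by ring.
  rewrite <- !sum_scal, <- sum_add.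
  apply sum_eq_loc; intros k hk.
  pose proof (INR_ge_1 k ltac:(lia)).
  replace (INR k * (2 * x)) with (2 * (INR k * x)) by ring.
  rewrite sin_2a; field; lra.
Qed.

Lemma blocks_of_continuous (b : nat -> R) (B : R) (f : R -> R) :
  (forall n, (1 <= n)%nat -> 0 <= b n) ->
  (forall n, (1 <= n)%nat -> Rabs (b n) <= B) ->
  (forall x, is_lim_seq (fun N => sin_partial b N x) (f x)) ->
  continuity_pt f 0 ->
  forall eps, 0 < eps -> exists m0, forall m, (1 <= m)%nat -> (m0 <= m)%nat ->
    sum_n_m b m (2 * m) <= eps.
Proof.
intros Hb HB Hf Hc eps he.
destruct (int2_partial_unif_cauchy b B HB) as [G HG].
assert (HGc : forall x, continuity_pt G x).
{ apply (unif_lim_continuity _ _ HG); intros N x; unfold int2_partial.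
  apply (continuity_pt_sum (fun n y => b n / INR n ^ 2 * sin (INR n * y))).
  intros k; apply ex_derive_continuity_pt; auto_derive; trivial. }
assert (f0 : f 0 = 0).
{ assert (E : is_lim_seq (fun N => sin_partial b N 0) 0).
  { apply is_lim_seq_ext with (fun _ => 0); [|apply is_lim_seq_const].
    intros N; unfold sin_partial.
    rewrite (sum_eq_loc _ (fun _ => 0)); [rewrite sum_n_m_const; ring|].
    intros k _; rewrite Rmult_0_r, sin_0; ring. }
  apply is_lim_seq_unique in E; pose proof (is_lim_seq_unique _ _ (Hf 0)) as E'.
  rewrite E in E'; now injection E'. }
assert (hcos : 0 < 1 - cos 1).
{ pose proof PI2_1; pose proof PI_4.
  pose proof (cos_decreasing_1 0 1) as h; rewrite cos_0 in h; lra. }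
(* A lower bound of [(1 - cos t)^2] for [1 <= t <= 2], the range of [n x] when [x = 1 / m] and
   [m <= n <= 2 m]. *)
set (c := (1 - cos 1) ^ 2).
assert (hc : 0 < c) by (apply pow_lt; exact hcos).
(* Together with [nu] below, this makes the final bound exactly [c / (8 m^3) * (eps + eta)]. *)
set (e := eps * c / 8).
assert (hep : 0 < e) by (unfold e; nra).
destruct (Hc e hep) as [d [hd Hd]].
assert (Hfe : forall x, 0 <= x < d -> Rabs (f x) <= e).
{ intros x hx; destruct (Req_dec x 0) as [->|hx0]; [rewrite f0, Rabs_R0; lra|].
  specialize (Hd x); simpl in Hd; unfold R_dist in Hd.
  rewrite f0, !Rminus_0_r in Hd.
  left; apply Hd; split; [split; [exact I | lra] | rewrite Rabs_pos_eq; lra]. }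
(* Second differences centred at [t <= 1 / m] with step [t] reach up to [2 t], hence the requirement
   [2 / m < d]. *)
destruct (INR_unbounded (2 / d)) as [m0 hm0].
exists m0; intros m hm1 hm.
assert (hmR : 1 <= INR m) by now apply INR_ge_1.
assert (hmd : 2 * / INR m < d).
{ apply (Rlt_div_l _ _ d) in hm0; [|exact hd].
  apply (Rmult_lt_reg_r (INR m)); [lra|].
  rewrite Rmult_assoc, Rinv_l by lra.
  apply le_INR in hm; nra. }
set (x := / INR m) in *.
assert (hx : 0 < x) by (apply Rinv_0_lt_compat; lra).
(* The maximum principle on [[0, 2 t]], where [|f| <= e] controls the second symmetric derivative of
   [G]. *)
assert (HD : forall t, 0 < t <= x -> Rabs (G (2 * t) + G 0 - 2 * G t) <= e * t ^ 2).
{ intros t ht.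
  pose proof (second_difference_bound G t t e (proj1 ht)) as H.
  replace (t + t) with (2 * t) in H by ring; rewrite Rminus_diag in H.
  apply H; [intros; apply HGc|].
  intros y hy eta heta.
  destruct (int2_schwarz_derivative b f G Hf HG y eta heta) as [dl [hdl Hdl]].
  exists dl; split; [exact hdl|]; intros h hh.
  specialize (Hdl h hh); pose proof (Hfe y ltac:(lra)) as hf.
  apply Rabs_le_between in Hdl; apply Rabs_le_between in hf.
  assert (0 <= h ^ 2) by apply pow2_ge_0.
  assert (- e * h ^ 2 <= f y * h ^ 2 <= e * h ^ 2) by (split; apply Rmult_le_compat_r; lra).
  apply Rabs_le; lra. }
apply Rle_plus_epsilon; intros eta heta.
set (nu := eta * c / (32 * INR m ^ 2)).
assert (hm2 : 0 < INR m ^ 2) by (apply pow_lt; lra).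
assert (hnu : 0 < nu) by (apply Rdiv_lt_0_compat; nra).
destruct (HG nu hnu) as [N0 HN].
set (N := Nat.max N0 (2 * m)).
specialize (HN N (Nat.le_max_l _ _)).
(* Mean value theorem on [[0, x]]; passing between partial sums and [G] costs [nu] at 0 and at
   [2 t], and [2 nu] at [t]. *)
assert (HP : int3_partial b N x <= (e * x ^ 2 + 4 * nu) * x).
{ destruct (MVT_gen (int3_partial b N) 0 x
    (fun t => 2 * int2_partial b N t - int2_partial b N (2 * t))) as [t [ht E]].
  - intros t _; apply is_derive_int3.
  - intros t _; apply ex_derive_continuity_pt; eexists; apply is_derive_int3.
  - rewrite Rmin_left, Rmax_right in ht by lra.
    assert (E0 : int3_partial b N 0 = 0).
    { unfold int3_partial; rewrite (sum_eq_loc _ (fun _ => 0)).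
      - rewrite sum_n_m_const; ring.
      - intros k _; rewrite Rmult_0_r, cos_0; ring. }
    assert (E2 : int2_partial b N 0 = 0).
    { unfold int2_partial; rewrite (sum_eq_loc _ (fun _ => 0)).
      - rewrite sum_n_m_const; ring.
      - intros k _; rewrite Rmult_0_r, sin_0; ring. }
    rewrite E0, !Rminus_0_r in E; rewrite E.
    apply Rmult_le_compat_r; [lra|].
    pose proof (HN 0) as h0; rewrite E2 in h0.
    pose proof (HN t) as h1; pose proof (HN (2 * t)) as h2.
    apply Rabs_lt_between in h0; apply Rabs_lt_between in h1; apply Rabs_lt_between in h2.
    assert (h3 : Rabs (G (2 * t) + G 0 - 2 * G t) <= e * x ^ 2).
    { destruct (proj1 ht) as [ht0|<-].
      - apply Rle_trans with (1 := HD t (conj ht0 (proj2 ht))).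
        apply Rmult_le_compat_l; [lra|]; apply pow_incr; lra.
      - rewrite Rmult_0_r; replace (G 0 + G 0 - 2 * G 0) with 0 by ring.
        rewrite Rabs_R0; apply Rmult_le_pos; [lra | apply pow2_ge_0]. }
    apply Rabs_le_between in h3; lra. }
(* The terms are nonnegative, so only [m <= n <= 2 m] is kept, where [1 / n^3 >= 1 / (8 m^3)]. *)
assert (HQ : c / (8 * INR m ^ 3) * sum_n_m b m (2 * m) <= int3_partial b N x).
{ unfold int3_partial.
  apply Rle_trans with
    (sum_n_m (fun n => b n / INR n ^ 3 * (1 - cos (INR n * x)) ^ 2) m (2 * m)).
  - rewrite <- sum_scal; apply sum_le_loc; intros k hk.
    assert (hk1 : INR m <= INR k) by (apply le_INR; lia).
    assert (hk2 : INR k <= 2 * INR m)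
      by (replace (2 * INR m) with (INR (2 * m)) by (rewrite mult_INR; reflexivity);
          apply le_INR; lia).
    assert (hkx : 1 <= INR k * x <= 2).
    { unfold x; split; [apply (Rle_div_r _ _ (INR m)) | apply (Rle_div_l _ _ (INR m))]; lra. }
    replace (c / (8 * INR m ^ 3) * b k) with (b k * / (8 * INR m ^ 3) * c)
      by (field; lra).
    apply Rmult_le_compat.
    + apply Rmult_le_pos; [apply Hb; lia|].
      left; apply Rinv_0_lt_compat; assert (0 < INR m ^ 3) by (apply pow_lt; lra); lra.
    + lra.
    + apply Rmult_le_compat_l; [apply Hb; lia|].
      apply Rinv_le_contravar; [apply pow_lt; lra|].
      replace (8 * INR m ^ 3) with ((2 * INR m) ^ 3) by ring.
      apply pow_incr; lra.
    + apply pow_incr; split; [lra|].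
      assert (cos (INR k * x) <= cos 1).
      { apply cos_decr_1; pose proof PI2_1; lra. }
      lra.
  - apply sum_sub_le; try lia.
    intros k hk; pose proof (INR_ge_1 k ltac:(lia)).
    apply Rmult_le_pos; [|apply pow2_ge_0].
    apply Rdiv_le_0_compat; [apply Hb; lia | apply pow_lt; lra]. }
assert (H8 : 0 < c / (8 * INR m ^ 3)).
{ apply Rdiv_lt_0_compat; [exact hc|]; assert (0 < INR m ^ 3) by (apply pow_lt; lra); lra. }
apply (Rmult_le_reg_l _ _ _ H8).
apply Rle_trans with (1 := HQ), Rle_trans with (1 := HP).
right; unfold x, e, nu; field; lra.
Qed.

(** * NBVS estimates, from blocks to [n b_n] *)

Definition real_NBVS (b : nat -> R) (K : R) : Prop :=
  forall m, (1 <= m)%nat ->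
    sum_n_m (fun n => Rabs (b n - b (S n))) m (2 * m) <= K * (b m + b (2 * m)%nat).

Lemma NBVS_real (b : nat -> R) :
  (forall n, (1 <= n)%nat -> 0 <= b n) -> NBVS (fun n => RtoC (b n)) ->
  exists K, 0 < K /\ real_NBVS b K.
Proof.
intros Hb [_ [K [hK HK]]]; exists K; split; [exact hK|]; intros m hm.
specialize (HK m hm).
rewrite !Cmod_R, !Rabs_pos_eq in HK by (apply Hb; lia).
apply Rle_trans with (2 := HK); right.
apply sum_eq_loc; intros k _; now rewrite <- RtoC_minus, Cmod_R.
Qed.

(** [b n] differs from [b j] by a telescoping sum of differences inside the window [[j, 2 j]] that
    the condition controls. *)
Lemma NBVS_pointwise (b : nat -> R) (K : R) (j n : nat) :
  (forall n, (1 <= n)%nat -> 0 <= b n) -> 0 < K -> real_NBVS b K ->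
  (1 <= j <= n)%nat -> (n <= 2 * j)%nat -> b n <= (K + 1) * (b j + b (2 * j)%nat).
Proof.
intros Hb hK HK hj hn.
pose proof (HK j (proj1 hj)) as H.
pose proof (Hb (2 * j)%nat ltac:(lia)).
destruct n as [|n]; [lia|].
assert (E : b (S n) = b j - sum_n_m (fun k => b k - b (S k)) j n)
  by (rewrite sum_telescope by lia; ring).
assert (h : Rabs (sum_n_m (fun k => b k - b (S k)) j n)
  <= sum_n_m (fun k => Rabs (b k - b (S k))) j (2 * j)).
{ apply Rle_trans with (1 := Rabs_sum_le _ _ _).
  apply sum_sub_le; try lia; intros; apply Rabs_pos. }
apply Rabs_le_between in h; lra.
Qed.

Lemma sum_double_le (b : nat -> R) (m n : nat) :
  (forall n, (1 <= n)%nat -> 0 <= b n) -> (1 <= m)%nat ->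
  sum_n_m (fun j => b (2 * j)%nat) m n <= sum_n_m b (2 * m) (2 * n).
Proof.
intros Hb hm; induction n as [|n IH].
- rewrite !sum_empty by lia; lra.
- destruct (le_lt_dec m (S n)) as [h|h].
  + rewrite sum_last by lia.
    replace (2 * S n)%nat with (S (S (2 * n))) by lia.
    destruct (Nat.eq_dec m (S n)) as [->|hne].
    * rewrite (sum_empty _ (S n)) by lia.
      replace (2 * S n)%nat with (S (S (2 * n))) by lia; rewrite sum_single; lra.
    * rewrite !sum_last by lia.
      pose proof (Hb (S (2 * n)) ltac:(lia)); lra.
  + rewrite sum_empty by lia; apply sum_nonneg; intros; apply Hb; lia.
Qed.

(** Summing [NBVS_pointwise] over [m <= j <= n] with [m] about [n / 2] counts [b n] at least [n / 2]
    times, against parts of the blocks starting at [m] and at [2 m]. *)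
Lemma lim_of_blocks (b : nat -> R) (K : R) :
  (forall n, (1 <= n)%nat -> 0 <= b n) -> 0 < K -> real_NBVS b K ->
  (forall eps, 0 < eps -> exists m0, forall m, (1 <= m)%nat -> (m0 <= m)%nat ->
    sum_n_m b m (2 * m) <= eps) ->
  is_lim_seq (fun n => INR n * b n) 0.
Proof.
intros Hb hK HK HB.
apply is_lim_seq_spec; intros [eps he]; simpl.
(* The final estimate is [2 * (K + 1) * (e + e) = 4 * eps / 5]. *)
set (e := eps / (5 * (K + 1))).
assert (hep : 0 < e) by (apply Rdiv_lt_0_compat; lra).
destruct (HB e hep) as [m0 Hm0].
exists (S (2 * m0)); intros n hn.
(* [m] is [n / 2] rounded up: [n <= 2 m] puts [n] in every window, and [2 m <= n + 1] leaves enough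
   indices [j]. *)
assert (hm : exists m, (1 <= m)%nat /\ (m0 <= m)%nat /\ (n <= 2 * m)%nat /\ (2 * m <= S n)%nat).
{ destruct (Nat.Even_or_Odd n) as [[k hk]|[k hk]]; [exists k | exists (S k)]; lia. }
destruct hm as [m [h1 [h2 [h3 h4]]]].
assert (H1 : sum_n_m b m n <= e).
{ apply Rle_trans with (2 := Hm0 m h1 h2).
  apply sum_sub_le; try lia; intros; apply Hb; lia. }
assert (H2 : sum_n_m (fun j => b (2 * j)%nat) m n <= e).
{ apply Rle_trans with (1 := sum_double_le b m n Hb h1).
  apply Rle_trans with (2 := Hm0 (2 * m)%nat ltac:(lia) ltac:(lia)).
  apply sum_sub_le; try lia; intros; apply Hb; lia. }
assert (H3 : sum_n_m (fun _ => b n) m n <= (K + 1) * (sum_n_m b m n + sum_n_m (fun j => b (2 * j)%nat) m n)).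
{ rewrite <- sum_add, <- sum_scal; apply sum_le_loc; intros j hj.
  apply NBVS_pointwise; trivial; lia. }
rewrite sum_n_m_const in H3.
pose proof (Hb n ltac:(lia)) as hbn.
assert (h5 : INR n <= 2 * INR (S n - m)).
{ change 2 with (INR 2); rewrite <- mult_INR; apply le_INR; lia. }
assert (hE : (K + 1) * e = eps / 5) by (unfold e; field; lra).
assert ((K + 1) * (sum_n_m b m n + sum_n_m (fun j => b (2 * j)%nat) m n) <= (K + 1) * (e + e))
  by (apply Rmult_le_compat_l; lra).
rewrite Rminus_0_r, Rabs_pos_eq by (apply Rmult_le_pos; [apply pos_INR | exact hbn]).
apply Rle_lt_trans with (2 * INR (S n - m) * b n); [now apply Rmult_le_compat_r | lra].
Qed.

Lemma blocks_of_unif_conv (b : nat -> R) :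
  (forall n, (1 <= n)%nat -> 0 <= b n) -> sin_series_unif_conv b ->
  forall eps, 0 < eps -> exists m0, forall m, (1 <= m)%nat -> (m0 <= m)%nat ->
    sum_n_m b m (2 * m) <= eps.
Proof.
intros Hb [f Hf] eps he.
set (c := sin (1 / 2)).
assert (hc : 0 < c) by (apply sin_pos_tech; lra).
destruct (Hf (eps * c / 2)) as [N0 HN]; [nra|].
exists (S N0); intros m hm1 hm.
destruct m as [|m]; [lia|].
(* For [S m <= k <= 2 * S m] this puts [k x] in [[1/2, 1]], where the sine is at least [c]. *)
set (x := / (2 * INR (S m))).
assert (hmR : 1 <= INR (S m)) by now apply INR_ge_1.
pose proof (HN m ltac:(lia) x) as h1; pose proof (HN (2 * S m)%nat ltac:(lia) x) as h2.
apply Rabs_lt_between in h1; apply Rabs_lt_between in h2.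
assert (E : sin_partial b (2 * S m) x - sin_partial b m x =
  sum_n_m (fun n => b n * sin (INR n * x)) (S m) (2 * S m))
  by (apply sum_sub_1; lia).
assert (c * sum_n_m b (S m) (2 * S m) <=
  sum_n_m (fun n => b n * sin (INR n * x)) (S m) (2 * S m)).
{ rewrite <- sum_scal; apply sum_le_loc; intros k hk.
  rewrite (Rmult_comm c); apply Rmult_le_compat_l; [apply Hb; lia|].
  assert (hk1 : INR (S m) <= INR k) by (apply le_INR; lia).
  assert (hk2 : INR k <= 2 * INR (S m))
    by (change 2 with (INR 2); rewrite <- mult_INR; apply le_INR; lia).
  assert (1 / 2 <= INR k * x <= 1).
  { unfold x; split; [apply (Rle_div_r _ _ (2 * INR (S m))) | apply (Rle_div_l _ _ (2 * INR (S m)))]; lra. }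
  pose proof PI2_1; apply sin_incr_1; lra. }
apply (Rmult_le_reg_l c); lra.
Qed.

(* Off the multiples of 3, both [j] and [2 * j] have [|sin (2 j pi / 3)| = sqrt 3 / 2]. *)
Lemma coefficients_bounded (b : nat -> R) (K : R) (f : R -> R) :
  (forall n, (1 <= n)%nat -> 0 <= b n) -> 0 < K -> real_NBVS b K ->
  (forall x, is_lim_seq (fun N => sin_partial b N x) (f x)) ->
  exists B, forall n, (1 <= n)%nat -> Rabs (b n) <= B.
Proof.
intros Hb hK HK Hf.
set (x := 2 * (PI / 3)).
destruct (filterlim_bounded (fun N => sin_partial b N x)) as [M HM].
{ exists (f x); exact (Hf x). }
assert (hM : forall n, (1 <= n)%nat -> Rabs (b n * sin (INR n * x)) <= 2 * M).
{ intros n hn; destruct n as [|n]; [lia|].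
  pose proof (HM n) as h1; pose proof (HM (S n)) as h2.
  unfold norm in h1, h2; simpl in h1, h2; unfold abs in h1, h2; simpl in h1, h2.
  assert (E : b (S n) * sin (INR (S n) * x) = sin_partial b (S n) x - sin_partial b n x).
  { unfold sin_partial; rewrite sum_last by lia; ring. }
  rewrite E; apply Rabs_le_between in h1; apply Rabs_le_between in h2.
  apply Rabs_le; lra. }
assert (hs : 0 < sin x) by (apply sin_gt_0; unfold x; pose proof PI_RGT_0; lra).
assert (hM0 : 0 <= M) by (apply Rle_trans with (2 := HM 0%nat), norm_ge_0).
assert (Hsin : forall q r, (r = 1 \/ r = 2)%nat -> Rabs (sin (INR (3 * q + r) * x)) = sin x).
{ intros q r hr.
  rewrite plus_INR, mult_INR.
  replace ((INR 3 * INR q + INR r) * x) with (INR r * x + 2 * INR q * PI)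
    by (unfold x; simpl; field).
  rewrite sin_period.
  destruct hr as [-> | ->]; simpl.
  - rewrite Rmult_1_l; apply Rabs_pos_eq; lra.
  - replace ((1 + 1) * x) with (- x + 2 * PI) by (unfold x; field).
    rewrite sin_plus, sin_2PI, cos_2PI, sin_neg, Rmult_0_r, Rplus_0_r, Rmult_1_r, Rabs_Ropp.
    apply Rabs_pos_eq; lra. }
assert (H3 : forall q r, (r = 1 \/ r = 2)%nat -> b (3 * q + r)%nat <= 2 * M / sin x).
{ intros q r hr; apply (Rle_div_r _ _ (sin x)); [exact hs|].
  apply Rle_trans with (2 := hM (3 * q + r)%nat ltac:(lia)).
  rewrite Rabs_mult, Hsin by exact hr.
  apply Rmult_le_compat_r; [lra | apply RRle_abs]. }
assert (hL : 0 <= 2 * M / sin x) by (apply Rdiv_le_0_compat; lra).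
exists ((K + 1) * (2 * M / sin x + 2 * M / sin x)); intros n hn.
rewrite Rabs_pos_eq by (apply Hb; lia).
(* [j = 3 q + r] is [n] itself, or [n - 1] when 3 divides [n]; then neither [j] nor [2 j] is a
   multiple of 3, and [n <= 2 j]. *)
assert (Hj : exists q r s t, (r = 1 \/ r = 2)%nat /\ (t = 1 \/ t = 2)%nat /\
  (2 * (3 * q + r) = 3 * s + t)%nat /\ (3 * q + r <= n)%nat /\ (n <= 2 * (3 * q + r))%nat).
{ pose proof (Nat.div_mod_eq n 3) as E; pose proof (Nat.mod_upper_bound n 3 ltac:(lia)).
  revert E H; generalize (n / 3)%nat (n mod 3)%nat; intros q r E H.
  destruct r as [|[|[|r]]]; [|exists q, 1%nat, (2 * q)%nat, 2%nat; lia
    |exists q, 2%nat, (2 * q + 1)%nat, 1%nat; lia|lia].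
  exists (q - 1)%nat, 2%nat, (2 * (q - 1) + 1)%nat, 1%nat; lia. }
destruct Hj as [q [r [s [t [hr [ht [E [h1 h2]]]]]]]].
apply Rle_trans with (1 := NBVS_pointwise b K (3 * q + r) n Hb hK HK ltac:(lia) h2).
apply Rmult_le_compat_l; [lra|].
rewrite E; apply Rplus_le_compat; now apply H3.
Qed.

(** * Uniform convergence from [n b_n -> 0] *)

(** The dyadic block starting at [2^i * p] contributes at most [3/2 * K * eps / (2^i * p)], and the
    geometric series doubles the first bound. *)
Lemma variation_tail (b : nat -> R) (K eps : R) (N : nat) :
  (forall n, (1 <= n)%nat -> 0 <= b n) -> 0 < K -> real_NBVS b K ->
  0 < eps -> (forall n, (N <= n)%nat -> INR n * b n <= eps) ->
  forall p q, (1 <= p)%nat -> (N <= p)%nat ->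
  sum_n_m (fun k => Rabs (b k - b (S k))) p q <= 3 * K * eps / INR p.
Proof.
intros Hb hK HK he HN.
set (v := fun k => Rabs (b k - b (S k))).
assert (Hv : forall k, 0 <= v k) by (intros; apply Rabs_pos).
assert (Hdy : forall j p, (1 <= p)%nat -> (N <= p)%nat ->
  sum_n_m v p (2 ^ j * p) <= 3 * K * eps / INR p).
{ assert (Hbp : forall p, (1 <= p)%nat -> (N <= p)%nat -> b p <= eps / INR p).
  { intros p hp hNp; pose proof (INR_ge_1 p hp).
    apply (Rle_div_r _ _ (INR p)); [lra|]. rewrite Rmult_comm; now apply HN. }
  assert (Hblock : forall p, (1 <= p)%nat -> (N <= p)%nat ->
    sum_n_m v p (2 * p) <= K * (eps / INR p + eps / (2 * INR p))).
  { intros p hp hNp; apply Rle_trans with (1 := HK p hp).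
    apply Rmult_le_compat_l; [lra|].
    pose proof (Hbp p hp hNp); pose proof (Hbp (2 * p)%nat ltac:(lia) ltac:(lia)) as h2.
    rewrite mult_INR in h2; change (INR 2) with 2 in h2; lra. }
  induction j as [|j IH]; intros p hp hNp; pose proof (INR_ge_1 p hp).
  - rewrite Nat.mul_1_l.
    apply Rle_trans with (sum_n_m v p (2 * p)).
    + apply sum_sub_le; try lia; intros; apply Hv.
    + apply Rle_trans with (1 := Hblock p hp hNp).
      assert (0 < K * eps / INR p) by (apply Rdiv_lt_0_compat; nra).
      replace (K * (eps / INR p + eps / (2 * INR p))) with (3 / 2 * (K * eps / INR p))
        by (field; lra).
      replace (3 * K * eps / INR p) with (3 * (K * eps / INR p)) by (field; lra); lra.
  - assert (h2j : (1 <= 2 ^ j)%nat) by (pose proof (Nat.pow_nonzero 2 j); lia).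
    (* Peel off the first block and use the induction hypothesis at [2 * p]; each part is worth half
       of [3 * K * eps / p]. *)
    replace (2 ^ S j * p)%nat with (2 ^ j * (2 * p))%nat by (simpl; ring).
    rewrite (sum_Chasles v p (2 * p)) by nia.
    specialize (IH (2 * p)%nat ltac:(lia) ltac:(lia)).
    pose proof (Hblock p hp hNp) as h1.
    assert (h2 : sum_n_m v (S (2 * p)) (2 ^ j * (2 * p)) <= sum_n_m v (2 * p) (2 ^ j * (2 * p))).
    { apply sum_sub_le; try nia; intros; apply Hv. }
    rewrite mult_INR in IH; change (INR 2) with 2 in IH.
    replace (3 * K * eps / INR p) with
      (K * (eps / INR p + eps / (2 * INR p)) + 3 * K * eps / (2 * INR p))
      by (field; lra).
    lra. }
intros p q hp hNp.
destruct (le_lt_dec p (S q)) as [h|h].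
(* Since [q < 2^q], [q] doublings of [p] reach past [q]. *)
- apply Rle_trans with (2 := Hdy q p hp hNp).
  assert (q < 2 ^ q)%nat by (apply Nat.pow_gt_lin_r; lia).
  apply sum_sub_le; try nia; intros; apply Hv.
- rewrite sum_empty by lia; apply Rdiv_le_0_compat; [nra|].
  pose proof (INR_ge_1 p hp); lra.
Qed.

(* With [s = |sin (x/2)|], terms of index below [1/s] are bounded through
   [|sin (k x)| <= 2 k s], the others by summation by parts. *)
Lemma sin_tail_bound (b : nat -> R) (K eps : R) (N : nat) :
  (forall n, (1 <= n)%nat -> 0 <= b n) -> 0 < K -> real_NBVS b K ->
  0 < eps -> (1 <= N)%nat -> (forall n, (N <= n)%nat -> INR n * b n <= eps) ->
  forall x M, Rabs (sum_n_m (fun k => b k * sin (INR k * x)) N M) <= (3 * K + 3) * eps.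
Proof.
intros Hb hK HK he hN HN x M.
set (s := Rabs (sin (x / 2))).
assert (hs0 : 0 <= s) by apply Rabs_pos.
(* At most [q] terms, each at most [2 * eps * s] because [k * b k <= eps]. *)
assert (Hlow : forall q, INR q * s <= 1 ->
  Rabs (sum_n_m (fun k => b k * sin (INR k * x)) N q) <= 2 * eps).
{ intros q hq.
  apply Rle_trans with (1 := Rabs_sum_le _ _ _).
  apply Rle_trans with (sum_n_m (fun _ => 2 * eps * s) N q).
  - apply sum_le_loc; intros k hk.
    pose proof (Hb k ltac:(lia)) as hbk; pose proof (HN k (proj1 hk)).
    rewrite Rabs_mult, Rabs_pos_eq by exact hbk.
    replace (INR k * x) with (INR (k * 2) * (x / 2)) by (rewrite mult_INR; simpl; field).
    pose proof (Rabs_sin_mult_le (k * 2) (x / 2)) as hk2.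
    rewrite mult_INR in hk2; simpl (INR 2) in hk2; fold s in hk2.
    rewrite mult_INR; simpl (INR 2).
    apply Rle_trans with (b k * (INR k * (1 + 1) * s)).
    + now apply Rmult_le_compat_l.
    + replace (b k * (INR k * (1 + 1) * s)) with (2 * (INR k * b k) * s) by ring.
      apply Rmult_le_compat_r; lra.
  - rewrite sum_n_m_const.
    assert (INR (S q - N) <= INR q) by (apply le_INR; lia).
    pose proof (pos_INR (S q - N)).
    apply Rle_trans with (2 * eps * (INR q * s)); [|nra].
    replace (2 * eps * (INR q * s)) with (INR q * (2 * eps * s)) by ring.
    apply Rmult_le_compat_r; nra. }
(* The sine sums are at most [1 / s <= p], against a variation of at most [3 * K * eps / p]; the
   boundary term is at most [(M + 1) * b (M + 1) <= eps]. *)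
assert (Hhigh : forall p, (N <= p)%nat -> 1 <= INR p * s ->
  Rabs (sum_n_m (fun k => b k * sin (INR k * x)) p M) <= (3 * K + 1) * eps).
{ intros p hp hps.
  destruct (le_lt_dec p M) as [hpM|hpM].
  2:{ rewrite sum_empty, Rabs_R0 by lia; nra. }
  assert (hs : 0 < s).
  { destruct hs0 as [h|h]; [exact h|]; rewrite <- h in hps; lra. }
  pose proof (INR_ge_1 p ltac:(lia)) as hp1.
  assert (HS : forall k, (p <= S k)%nat -> Rabs (sum_n_m (fun k => sin (INR k * x)) p k) <= / s).
  { intros k hk; apply (Rmult_le_reg_l s); [exact hs|].
    rewrite Rinv_r by lra; apply sum_sin_bound; lia. }
  assert (his : / s <= INR p).
  { apply (Rmult_le_reg_r s); [exact hs|]; rewrite Rinv_l; lra. }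
  assert (0 < / s) by now apply Rinv_0_lt_compat.
  rewrite summation_by_parts by lia.
  apply Rle_trans with (1 := Rabs_triang _ _).
  assert (H1 : Rabs (sum_n_m (fun k => sum_n_m (fun k => sin (INR k * x)) p k * (b k - b (S k))) p M)
    <= 3 * K * eps).
  { apply Rle_trans with (1 := Rabs_sum_le _ _ _).
    apply Rle_trans with (/ s * sum_n_m (fun k => Rabs (b k - b (S k))) p M).
    - rewrite <- sum_scal; apply sum_le_loc; intros k hk.
      rewrite Rabs_mult; apply Rmult_le_compat_r; [apply Rabs_pos | apply HS; lia].
    - pose proof (variation_tail b K eps N Hb hK HK he HN p M ltac:(lia) hp) as hv.
      apply Rle_trans with (INR p * (3 * K * eps / INR p)); [|right; field; lra].
      apply Rmult_le_compat; try lra.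
      apply sum_nonneg; intros; apply Rabs_pos. }
  assert (H2 : Rabs (b (S M) * sum_n_m (fun k => sin (INR k * x)) p M) <= eps).
  { pose proof (Hb (S M) ltac:(lia)) as hb.
    rewrite Rabs_mult, (Rabs_pos_eq (b _)) by exact hb.
    apply Rle_trans with (b (S M) * INR (S M)).
    - apply Rmult_le_compat_l; [exact hb|].
      apply Rle_trans with (1 := HS M ltac:(lia)), Rle_trans with (1 := his).
      apply le_INR; lia.
    - rewrite Rmult_comm; apply HN; lia. }
  lra. }
destruct (Rle_lt_dec (INR M * s) 1) as [h|h].
{ apply Rle_trans with (1 := Hlow M h); nra. }
destruct (Rle_lt_dec 1 (INR N * s)) as [h'|h'].
{ apply Rle_trans with (1 := Hhigh N (le_n _) h'); nra. }
(* [p] is the last index with [p s <= 1]; the two bounds then add up to [(3 * K + 3) * eps]. *)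
assert (Hsplit : exists p, (N <= p < M)%nat /\ INR p * s <= 1 < INR (S p) * s).
{ clear - h h'.
  induction M as [|M IH].
  - simpl in h; lra.
  - destruct (Rle_lt_dec (INR M * s) 1) as [hM|hM].
    + exists M; split; [|lra]. split; [|lia].
      apply Nat.nlt_ge; intros hl.
      assert (INR (S M) <= INR N) by (apply le_INR; lia).
      pose proof (Rabs_pos (sin (x / 2))); fold s in H0.
      assert (INR (S M) * s <= INR N * s) by (apply Rmult_le_compat_r; lra).
      lra.
    + destruct (IH hM) as [p [hp1 hp2]]; exists p; split; [lia | exact hp2]. }
destruct Hsplit as [p [hp1 [hp2 hp3]]].
rewrite (sum_Chasles _ N p M) by lia.
apply Rle_trans with (1 := Rabs_triang _ _).
pose proof (Hlow p hp2); pose proof (Hhigh (S p) ltac:(lia) (Rlt_le _ _ hp3)).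
lra.
Qed.

Lemma unif_conv_of_lim (b : nat -> R) (K : R) :
  (forall n, (1 <= n)%nat -> 0 <= b n) -> 0 < K -> real_NBVS b K ->
  is_lim_seq (fun n => INR n * b n) 0 -> sin_series_unif_conv b.
Proof.
intros Hb hK HK Hl.
apply (unif_cauchy_lim (sin_partial b)); intros eps he.
apply is_lim_seq_spec in Hl.
assert (he1 : 0 < eps / (3 * K + 3)) by (apply Rdiv_lt_0_compat; lra).
destruct (Hl (mkposreal _ he1)) as [N0 HN]; simpl in HN.
exists N0; intros N M hN hM x.
unfold sin_partial; rewrite sum_sub_1 by lia.
apply Rle_trans with ((3 * K + 3) * (eps / (3 * K + 3))); [|right; field; lra].
apply sin_tail_bound; trivial; [lia|].
intros n hn; specialize (HN n ltac:(lia)).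
rewrite Rminus_0_r in HN; apply Rabs_lt_between in HN; lra.
Qed.

(** * The two equivalences *)

Theorem theorem3 (b : nat -> R)
  (hb_nonneg : forall n : nat, (1 <= n)%nat -> 0 <= b n)
  (hb_NBVS : NBVS (fun n => RtoC (b n))) :
  (sin_series_unif_conv b <-> is_lim_seq (fun n => INR n * b n) 0)
  /\
  (forall f : R -> R,
     (forall x : R, is_lim_seq (fun N => sin_partial b N x) (f x)) ->
     ((forall x : R, continuity_pt f x) <-> is_lim_seq (fun n => INR n * b n) 0)).
Proof.
destruct (NBVS_real b hb_nonneg hb_NBVS) as [K [hK HK]].
split; [split|].
- intros H; apply (lim_of_blocks b K); trivial.
  now apply blocks_of_unif_conv.
- now apply unif_conv_of_lim with K.
- intros f Hf; split.
  + intros Hc; apply (lim_of_blocks b K); trivial.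
    destruct (coefficients_bounded b K f hb_nonneg hK HK Hf) as [B HB].
    now apply blocks_of_continuous with B f.
  + intros Hl x.
    destruct (unif_conv_of_lim b K hb_nonneg hK HK Hl) as [g Hg].
    (* [f] and [g] are both the pointwise limit, hence equal, and [g] inherits continuity from the
       partial sums. *)
    apply continuity_pt_ext with g.
    * intros y.
      assert (E : is_lim_seq (fun N => sin_partial b N y) (g y)).
      { apply is_lim_seq_spec; intros [e he]; destruct (Hg e he) as [N0 HN].
        exists N0; intros N hN; now apply HN. }
      apply is_lim_seq_unique in E; pose proof (is_lim_seq_unique _ _ (Hf y)) as E'.
      rewrite E in E'; now injection E'.
    * apply (unif_lim_continuity (sin_partial b)); [exact Hg|]; intros N y.
      apply (continuity_pt_sum (fun n z => b n * sin (INR n * z))).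
      intros k; apply ex_derive_continuity_pt; auto_derive; trivial.
Qed.
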